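(* Let $A\in\mathbb{R}_+^{m\times m}$ and let $I=I_m$ be the identity matrix. Let $V_1,\dots,V_k$ be the vertex sets of the strongly connected components of the digraph $\vec G(A)$. Then: (1) $\rho(A,I)=\rho(A)$, and there exists $\mathbf{y}\in\mathbb{R}^m_+\setminus\{\mathbf{0}\}$ with $A\mathbf{y}=\rho(A)\mathbf{y}$. (2) There exists $\mathbf{x}=(x_1,\dots,x_m)^\top>\mathbf{0}$ with $\rho(A)=\max_{i\in[m]}\frac{(A\mathbf{x})_i}{x_i}$ if and only if the following holds: for every $j\in[k]$ with $\rho(A[V_j])=\rho(A)$, the vertex $\{V_j\}$ is a sink of the reduced digraph $\vec G(A)_{red}$. (3) If $A$ is irreducible, then a vector $\mathbf{x}$ with positive coordinates summing to $1$ satisfying the condition in (2) is unique. (4) $\hat\rho(A,I)=\min\{\rho(A[V_i]):\ \{V_i\}\text{ is a source of }\vec G(A)_{red}\}$, and there exists $\mathbf{w}\in\mathbb{R}^m_+\setminus\{\mathbf{0}\}$ with $A\mathbf{w}=\hat\rho(A,I)\mathbf{w}$.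
   Context: $[m]=\{1,\dots,m\}$. For $A,B\in\mathbb{R}_+^{m\times n}$ and $\mathbf{x}\in\mathbb{R}^n_+\setminus\{\mathbf{0}\}$, $r(A,B,\mathbf{x})=\max_{i\in[m]}\frac{(A\mathbf{x})_i}{(B\mathbf{x})_i}\in[0,\infty]$ with the conventions $\frac00=0$, $\frac c0=\infty$ for $c>0$; $\rho(A,B)=\inf\{r(A,B,\mathbf{x}):\mathbf{x}>\mathbf{0}\}$ and $\hat\rho(A,B)=\inf\{r(A,B,\mathbf{x}):\mathbf{x}\in\mathbb{R}^n_+\setminus\{\mathbf{0}\}\}$. $\rho(M)$ denotes the spectral radius of a square matrix $M$. For $A=[a_{ij}]\in\mathbb{R}_+^{m\times m}$, the digraph $\vec G(A)$ has vertex set $[m]$ and a directed edge $(i,j)$ iff $a_{ij}>0$. A strongly connected component is a maximal vertex set $W$ such that the induced subdigraph is strongly connected (any single vertex, with or without a loop, lies in one; a one-vertex digraph counts as strongly connected). $A$ is irreducible if $\vec G(A)$ is strongly connected. For $U\subseteq[m]$, $A[U]=[a_{ij}]_{i,j\in U}$ is the principal submatrix. The reduced digraph $\vec G(A)_{red}$ has vertices $\{V_1\},\dots,\{V_k\}$ (the strongly connected components) and an edge from $\{V_i\}$ to $\{V_j\}$, $i\ne j$, iff some edge of $\vec G(A)$ goes from a vertex of $V_i$ to a vertex of $V_j$. A vertex $\{V_p\}$ is a source if no edge of $\vec G(A)_{red}$ enters it, and a sink if no edge of $\vec G(A)_{red}$ leaves it. *)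

(* Defs.v *)
(* The ambient field is an arbitrary numClosedFieldType C
   (e.g. the complex numbers); real numbers are its real elements. *)
From HB Require Import structures.
From mathcomp Require Import all_boot all_order all_algebra.
From Stdlib Require Import ClassicalEpsilon.
Set Implicit Arguments. Unset Strict Implicit. Unset Printing Implicit Defensive.
Import Order.TTheory GRing.Theory Num.Theory.
Local Open Scope ring_scope.

Section Defs.
Variable C : numClosedFieldType.

(* Extended nonnegative reals [0,oo]: Some v = v, None = +oo. *)
Definition lee (a b : option C) : bool :=
  match b, a with
  | None, _ => true
  | Some _, None => false
  | Some b', Some a' => a' <= b'
  end.

Definition maxe (a b : option C) : option C :=
  match a, b with
  | Some a', Some b' => Some (if a' <= b' then b' else a')
  | _, _ => None
  end.

Definition ratio (a b : C) : option C :=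
  if b == 0 then (if a == 0 then Some 0 else None) else Some (a / b).

(* r(A,B,x) = max_i (Ax)_i/(Bx)_i  (for m >= 1; all ratios are >= 0) *)
Definition rfun (m n : nat) (A B : 'M[C]_(m, n)) (x : 'cV[C]_n) : option C :=
  \big[maxe/Some 0]_(i < m) ratio ((A *m x) i 0) ((B *m x) i 0).

Definition is_infe (S : option C -> Prop) (v : option C) : Prop :=
  (forall s, S s -> lee v s) /\
  (forall w, (forall s, S s -> lee w s) -> lee w v).

Definition nonneg_mx (m n : nat) (A : 'M[C]_(m, n)) : Prop :=
  forall i j, 0 <= A i j.
Definition nonneg_vec (n : nat) (x : 'cV[C]_n) : Prop := forall i, 0 <= x i 0.
Definition pos_vec (n : nat) (x : 'cV[C]_n) : Prop := forall i, 0 < x i 0.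

Definition rho_set (m n : nat) (A B : 'M[C]_(m, n)) (s : option C) : Prop :=
  exists x, pos_vec x /\ rfun A B x = s.
Definition rhohat_set (m n : nat) (A B : 'M[C]_(m, n)) (s : option C) : Prop :=
  exists x, nonneg_vec x /\ x != 0 /\ rfun A B x = s.

Definition is_spec_rad (n : nat) (M : 'M[C]_n) (r : C) : Prop :=
  (exists l, eigenvalue M l /\ `|l| = r) /\
  (forall l, eigenvalue M l -> `|l| <= r).
Definition spec_rad (n : nat) (M : 'M[C]_n) : C :=
  epsilon (inhabits 0) (is_spec_rad M).

Definition psubmx (m : nat) (A : 'M[C]_m) (U : {set 'I_m}) : 'M[C]_#|U| :=
  \matrix_(i, j) A (enum_val i) (enum_val j).

Definition edge_in (m : nat) (A : 'M[C]_m) (W : {set 'I_m}) : rel 'I_m :=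
  [rel i j | (i \in W) && (j \in W) && (0 < A i j)].

Definition strongly_connected_on (m : nat) (A : 'M[C]_m) (W : {set 'I_m}) : Prop :=
  forall i j, i \in W -> j \in W -> connect (edge_in A W) i j.

Definition is_scc (m : nat) (A : 'M[C]_m) (W : {set 'I_m}) : Prop :=
  W != set0 /\ strongly_connected_on A W /\
  (forall W' : {set 'I_m}, W \subset W' -> strongly_connected_on A W' -> W' = W).

Definition irreducible_mx (m : nat) (A : 'M[C]_m) : Prop :=
  strongly_connected_on A setT.

Definition edge_between (m : nat) (A : 'M[C]_m) (V W : {set 'I_m}) : bool :=
  [exists i in V, exists j in W, 0 < A i j].

Definition is_sink (m : nat) (A : 'M[C]_m) (V : {set 'I_m}) : Prop :=
  forall W, is_scc A W -> W != V -> ~~ edge_between A V W.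
Definition is_source (m : nat) (A : 'M[C]_m) (V : {set 'I_m}) : Prop :=
  forall W, is_scc A W -> W != V -> ~~ edge_between A W V.

End Defs.

(* Main.v *)
(* The real elements of C form a real closed field that need not be archimedean,
   so the Perron vector is obtained algebraically instead of by compactness.
   Let p be the characteristic polynomial of A and h = p adj(X - A) 1, so that
   (X - A) h = p^2 1.  The entries of h are positive to the right of rho(A):
   far to the right because l - A is then an M-matrix, and everywhere because a
   nonnegative h(l) with p(l) <> 0 satisfies A h(l) < l h(l), hence is positive,
   so that no entry can vanish at some l > rho(A).  Dividing h by the largest
   power of X - rho(A) gives a polynomial vector g with g(rho(A)) nonnegative
   and nonzero, and (rho(A) - A) g(rho(A)) = c 1 for some c >= 0.  If c were
   positive, then A g(rho(A)) < rho(A) g(rho(A)), which bounds every eigenvalue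
   strictly below rho(A); so c = 0.

   If A is irreducible, every real x with A x <= rho(A) x is a multiple of the
   Perron vector.  This gives uniqueness, and it excludes edges leaving a class
   of maximal spectral radius; conversely a positive x with A x <= rho(A) x is
   glued from Perron vectors of those classes and a large multiple of a vector
   with strict inequality on the others.  The support of any x >= 0 with
   A x <= s x is closed under predecessors, hence contains a source class. *)
Require Import Defs.
From HB Require Import structures.
From mathcomp Require Import all_boot all_order all_algebra.
From Stdlib Require Import ClassicalEpsilon.
Set Implicit Arguments.
Unset Strict Implicit.
Unset Printing Implicit Defensive.
Import Order.TTheory GRing.Theory Num.Theory.
Local Open Scope ring_scope.

(** * Real polynomials *)

Section RealPolynomials.
Variable C : numClosedFieldType.
Implicit Types (p q : {poly C}) (a b x z : C).

Lemma real_polyE q :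
  (q \is a polyOver Num.real) = (map_poly Num.conj q == q).
Proof.
apply/polyOverP/eqP => [qR|qJ i].
  by apply/polyP => i; rewrite coef_map /= conj_Creal.
by rewrite CrealE -{2}qJ coef_map.
Qed.

Lemma real_polyX q k :
  q \is a polyOver Num.real -> q ^+ k \is a polyOver Num.real.
Proof. by rewrite !real_polyE rmorphXn /= => /eqP->. Qed.

Lemma real_poly_mulIr p q : q != 0 -> q \is a polyOver Num.real ->
  p * q \is a polyOver Num.real -> p \is a polyOver Num.real.
Proof.
by rewrite !real_polyE rmorphM /= => q0 /eqP-> /eqP/(mulIf q0)->.
Qed.

Lemma real_poly_conj_root q z :
  q \is a polyOver Num.real -> root q z -> root q z^*.
Proof. by rewrite real_polyE => /eqP qJ qz; rewrite -qJ fmorph_root. Qed.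

Definition conj_pair_poly z : {poly C} := ('X - z^*%:P) * ('X - z%:P).

Lemma conj_pair_poly_real z : conj_pair_poly z \is a polyOver Num.real.
Proof. by rewrite real_polyE rmorphM /= !map_polyXsubC /= conjCK mulrC. Qed.

Lemma conj_pair_poly_neq0 z : conj_pair_poly z != 0.
Proof. by rewrite mulf_neq0 ?polyXsubC_eq0. Qed.

Lemma conj_pair_poly_gt0 z x :
  z \isn't Num.real -> x \is Num.real -> 0 < (conj_pair_poly z).[x].
Proof.
move=> zNR xR; rewrite hornerM !hornerXsubC -{1}(conj_Creal xR) -rmorphB /=.
rewrite mulrC mul_conjC_gt0 subr_eq0.
by apply: contraNneq zNR => <-.
Qed.

Lemma real_poly_ind (P : {poly C} -> Prop) :
    {in Num.real, forall c, P c%:P} ->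
    (forall q c, c \is Num.real -> P q -> P (q * ('X - c%:P))) ->
    (forall q z, z \isn't Num.real -> P q -> P (q * conj_pair_poly z)) ->
  {in polyOver Num.real, forall q, P q}.
Proof.
move=> Pconst Plin Ppair q qR.
have [n] := ubnP (size q); elim: n q qR => // n IH q qR; rewrite ltnS => le_q_n.
have [/size1_polyC->|q_gt1] := leqP (size q) 1.
  by apply: Pconst; apply/polyOverP.
have q0 : q != 0 by rewrite -size_poly_gt0 ltnW.
have /closed_rootP[z qz] : size q != 1 by rewrite gtn_eqF.
have /factor_theorem[q1 qE] := qz.
have size_q : size q = (size q1).+1.
  rewrite qE size_Mmonic ?monicXsubC ?size_XsubC ?addn2 //.
  by apply: contraNneq q0 => q10; rewrite qE q10 mul0r.
have [zR|zNR] := boolP (z \is Num.real).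
  rewrite qE; apply: Plin => //; apply: IH; last by rewrite -size_q.
  apply: (@real_poly_mulIr _ ('X - z%:P)); rewrite -?qE ?polyXsubC_eq0 //.
  by rewrite polyOverXsubC.
have zJ : z^* != z by rewrite -CrealE.
have /factor_theorem[q2 q1E] : root q1 z^*.
  have := real_poly_conj_root qR qz.
  by rewrite qE rootM root_XsubC (negPf zJ) orbF.
have {}qE : q = q2 * conj_pair_poly z by rewrite qE q1E mulrA.
rewrite qE; apply: Ppair => //; apply: IH.
  apply: real_poly_mulIr (conj_pair_poly_neq0 z) (conj_pair_poly_real z) _.
  by rewrite -qE.
rewrite (leq_trans _ le_q_n) // size_q ltnS q1E.
have [->|q20] := eqVneq q2 0; first by rewrite size_poly0.
by rewrite size_Mmonic ?monicXsubC // size_XsubC addn2 leqnSn.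
Qed.

Lemma real_poly_ivt q a b :
    q \is a polyOver Num.real -> a \is Num.real -> b \is Num.real ->
    a <= b -> q.[a] * q.[b] <= 0 ->
  exists2 x, a <= x <= b & root q x.
Proof.
move=> qR aR bR le_ab.
elim/real_poly_ind: q / qR => [c cR|q c cR IH|q z zNR IH].
- rewrite !hornerC -expr2 real_exprn_even_le0 //= => /eqP->.
  by exists a; rewrite ?lexx // root0.
- rewrite !hornerM mulrACA !hornerXsubC => sgn_q.
  have [a_le_c|c_lt_a] := real_leP aR cR; last first.
    have [|x abx qx] := IH; last by exists x; rewrite ?rootM ?qx.
    move: sgn_q; rewrite pmulr_lle0 // mulr_gt0 // subr_gt0 //.
    exact: lt_le_trans le_ab.
  have [c_le_b|b_lt_c] := real_leP cR bR.
    by exists c; rewrite ?a_le_c // rootM root_XsubC eqxx orbT.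
  have [|x abx qx] := IH; last by exists x; rewrite ?rootM ?qx.
  move: sgn_q; rewrite pmulr_lle0 // nmulr_rgt0 subr_lt0 //.
  exact: le_lt_trans b_lt_c.
rewrite !(hornerM q) mulrACA pmulr_lle0 ?mulr_gt0 ?conj_pair_poly_gt0 //.
case/IH=> x abx qx.
by exists x; rewrite ?rootM ?qx.
Qed.

Lemma poly_roots_seq q :
  q != 0 -> exists s : seq C, forall x, root q x = (x \in s).
Proof.
move=> q0; have [s ->] := closed_field_poly_normal q; exists s => x.
by rewrite rootZ ?lead_coef_eq0 // root_prod_XsubC.
Qed.

Lemma real_poly_ge0_right q a :
    q \is a polyOver Num.real -> a \is Num.real ->
    (forall x, a < x -> 0 <= q.[x]) ->
  0 <= q.[a].
Proof.
move=> qR aR q_ge0; have [//|qa_lt0] := real_leP (real0 C) (rpred_horner qR aR).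
have q0 : q != 0 by apply: contraTneq qa_lt0 => ->; rewrite horner0 ltxx.
have [s rootE] := poly_roots_seq q0.
have gt_real x : a < x -> x \is Num.real by move/ltW/ler_real <-.
have root_between b : a < b -> exists2 x, x \in [seq y <- s | a < y] & x <= b.
  move=> lt_ab.
  have qab_le0 : q.[a] * q.[b] <= 0 by rewrite nmulr_rle0 // q_ge0.
  have [x /andP[le_ax le_xb] qx] :=
    real_poly_ivt qR aR (gt_real b lt_ab) (ltW lt_ab) qab_le0.
  exists x => //; rewrite mem_filter -rootE qx andbT lt_neqAle le_ax andbT.
  by apply: contraTneq qa_lt0 => ->; rewrite (rootP qx) ltxx.
have [|x1 x1_root _] := root_between (a + 1); first by rewrite ltrDl.
case: (@real_arg_minP _ _ (SeqSub x1_root) xpredT val) => // [x _|x0 _ x0_min].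
  by have := valP x; rewrite mem_filter => /andP[/gt_real].
have /midf_lt[lt_ac lt_cx0] : a < val x0.
  by have := valP x0; rewrite mem_filter => /andP[].
have [x x_root le_xc] := root_between _ lt_ac.
by have := x0_min (SeqSub x_root) isT; rewrite lt_geF // (le_lt_trans le_xc).
Qed.

End RealPolynomials.

(** * Vectors of polynomials *)

Section PolynomialVectors.
Variables (R : comNzRingType) (n : nat).
Implicit Types (h : 'cV[{poly R}]_n) (A : 'M[R]_n) (l r : R).

Definition horner_vec h l : 'cV[R]_n := map_mx (horner_eval l) h.

Lemma horner_vecE h l i : horner_vec h l i 0 = (h i 0).[l].
Proof. by rewrite mxE. Qed.

Lemma poly_vec_factor_XsubC h r : h != 0 ->
  exists k g, h = ('X - r%:P) ^+ k *: g /\ horner_vec g r != 0.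
Proof.
case/cV0Pn=> i; have [d] := ubnP (size (h i 0)).
elim: d h => // d IH h; rewrite ltnS => size_h h_i.
have [hr0|hr] := eqVneq (horner_vec h r) 0; last first.
  by exists 0%N, h; rewrite expr0 scale1r.
have /fin_all_exists[f fE] : forall j, exists q, h j 0 = q * ('X - r%:P).
  by move=> j; apply/factor_theorem/eqP; move/colP/(_ j): hr0; rewrite !mxE.
have f_i : f i != 0 by apply: contraNneq h_i => fi0; rewrite fE fi0 mul0r.
have [||k [g [gE gr]]] := IH (\col_j f j).
- rewrite mxE; move: size_h.
  by rewrite fE size_Mmonic ?monicXsubC // size_XsubC addn2.
- by rewrite mxE.
exists k.+1, g; split=> //; apply/colP => j; move/colP/(_ j): gE.
by rewrite !mxE fE => ->; rewrite exprSr mulrAC.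
Qed.

Lemma horner_mul_char_poly_mx A h l :
  horner_vec (char_poly_mx A *m h) l =
    l *: horner_vec h l - A *m horner_vec h l.
Proof.
rewrite /horner_vec map_mxM -mul_scalar_mx -mulmxBl; congr (_ *m _).
apply/matrixP => i j; rewrite !mxE /= horner_evalE.
by rewrite hornerD hornerN hornerMn hornerX hornerC.
Qed.

(* Over a field, p^2 (X - A)^-1 1, where p is the characteristic polynomial:
   unlike the factor p, the square does not affect signs. *)
Definition resolvent_vec A : 'cV[{poly R}]_n :=
  char_poly A *: (\adj (char_poly_mx A) *m const_mx 1).

Lemma mul_char_poly_mx_resolvent A :
  char_poly_mx A *m resolvent_vec A = const_mx (char_poly A ^+ 2).
Proof.
rewrite -scalemxAr mulmxA mul_mx_adj mul_scalar_mx scalerA.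
by apply/colP => i; rewrite !mxE mulr1.
Qed.

Lemma horner_mul_char_poly_mx_resolvent A l :
  l *: horner_vec (resolvent_vec A) l - A *m horner_vec (resolvent_vec A) l =
    const_mx ((char_poly A).[l] ^+ 2).
Proof.
rewrite -horner_mul_char_poly_mx mul_char_poly_mx_resolvent.
by apply/colP => i; rewrite horner_vecE !mxE horner_exp.
Qed.

End PolynomialVectors.

Section RealPolynomialVectors.
Variables (C : numClosedFieldType) (n : nat).
Implicit Types (h : 'cV[{poly C}]_n) (A : 'M[C]_n) (l r : C).

Lemma horner_vec_real h l :
    h \is a mxOver (polyOver Num.real) -> l \is Num.real ->
  horner_vec h l \is a realmx.
Proof.
move=> /mxOverP hR lR; apply/mxOverP => i j.
by rewrite mxE; apply: rpred_horner.
Qed.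

Lemma horner_vec_ge0_right h r :
    h \is a mxOver (polyOver Num.real) -> r \is Num.real ->
    (forall l, r < l -> nonneg_vec (horner_vec h l)) ->
  nonneg_vec (horner_vec h r).
Proof.
move=> /mxOverP hR rR h_ge0 i; rewrite horner_vecE.
apply: real_poly_ge0_right => // l lt_rl.
by rewrite -horner_vecE; apply: h_ge0.
Qed.

(* At the largest root l > r of an entry, h(l) would be nonnegative and not
   positive. *)
Lemma horner_vec_gt0_right h r :
    h \is a mxOver (polyOver Num.real) -> r \is Num.real ->
    {in Num.real, forall l, exists2 b, l <= b & pos_vec (horner_vec h b)} ->
    (forall l, r < l ->
       nonneg_vec (horner_vec h l) -> pos_vec (horner_vec h l)) ->
  forall l, r < l -> pos_vec (horner_vec h l).
Proof.
move=> hR rR pos_large pos_of_nonneg.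
have gt_real l : r < l -> l \is Num.real by move/ltW/ler_real <-.
pose P := \prod_i h i 0.
have root_prodE x : root P x = [exists i, root (h i 0) x].
  rewrite /root horner_prod.
  by apply/prodf_eq0/existsP => [[i _]|[i]]; exists i.
have P0 : P != 0.
  have [b _ b_pos] := pos_large r rR; apply/negP => /eqP P0.
  have : root P b by rewrite P0 root0.
  by rewrite root_prodE => /existsP[i]; rewrite /root -horner_vecE gt_eqF.
have [s rootE] := poly_roots_seq P0.
have root_above l i : r < l -> ~~ (0 < (h i 0).[l]) ->
    exists2 x, x \in [seq y <- s | r < y] & l <= x.
  move=> lt_rl hl_npos; have lR := gt_real l lt_rl.
  have hiR := mxOverP hR i 0; have [b le_lb b_pos] := pos_large l lR.
  have bR : b \is Num.real by rewrite -(ler_real le_lb).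
  have [|x /andP[le_lx le_xb] hx] := real_poly_ivt hiR lR bR le_lb.
    rewrite -(horner_vecE h b) pmulr_lle0 //.
    by rewrite real_leNgt ?real0 ?rpred_horner.
  exists x => //; rewrite mem_filter (lt_le_trans lt_rl) // -rootE root_prodE.
  by apply/existsP; exists i.
move=> l lt_rl i; rewrite horner_vecE; apply: contraT => hl_npos.
have [x1 x1_root _] := root_above l i lt_rl hl_npos.
case: (@real_arg_maxP _ _ (SeqSub x1_root) xpredT val) => // [x _|x0 _ x0_max].
  by have := valP x; rewrite mem_filter => /andP[/gt_real].
have := valP x0; rewrite mem_filter -rootE root_prodE.
case/andP=> lt_rx0 /existsP[j]; rewrite /root -horner_vecE gt_eqF //.
apply: pos_of_nonneg => //.
apply: horner_vec_ge0_right (gt_real _ lt_rx0) _ => // y lt_x0y k.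
have lt_ry := lt_trans lt_rx0 lt_x0y.
rewrite horner_vecE; apply: contraT => hy_nneg.
have [|x x_root le_yx] := root_above y k lt_ry.
  by apply: contra hy_nneg => /ltW.
have le_xx0 : x <= val x0 := x0_max (SeqSub x_root) isT.
by move: lt_x0y; rewrite le_gtF // (le_trans le_yx).
Qed.

Lemma real_poly_vec_factor_XsubC h r :
    h \is a mxOver (polyOver Num.real) -> r \is Num.real -> h != 0 ->
    (forall l, r < l -> nonneg_vec (horner_vec h l)) ->
  exists k g, [/\ h = ('X - r%:P) ^+ k *: g, g \is a mxOver (polyOver Num.real),
                  nonneg_vec (horner_vec g r) & horner_vec g r != 0].
Proof.
move=> hR rR /poly_vec_factor_XsubC-/(_ r)[k [g [hE gr]]] h_ge0.
have gR : g \is a mxOver (polyOver Num.real).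
  apply/mxOverP => i j; apply: (@real_poly_mulIr _ _ (('X - r%:P) ^+ k)).
  - by rewrite expf_neq0 // polyXsubC_eq0.
  - by rewrite real_polyX // polyOverXsubC.
  by have := mxOverP hR i j; rewrite hE mxE mulrC.
exists k, g; split=> //; apply: horner_vec_ge0_right => // l lt_rl i.
have := h_ge0 l lt_rl i; rewrite !horner_vecE hE mxE hornerM.
by rewrite pmulr_rge0 // horner_exp hornerXsubC exprn_gt0 // subr_gt0.
Qed.

Lemma realmx_conj A : A \is a realmx -> map_mx Num.conj A = A.
Proof.
by move=> /mxOverP AR; apply/matrixP => i j; rewrite mxE /= conj_Creal.
Qed.

Lemma char_poly_real A : A \is a realmx -> char_poly A \is a polyOver Num.real.
Proof. by move=> AR; rewrite real_polyE map_char_poly realmx_conj. Qed.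

Lemma resolvent_vec_real A :
  A \is a realmx -> resolvent_vec A \is a mxOver (polyOver Num.real).
Proof.
move=> AR.
suff hJ : map_mx (map_poly Num.conj) (resolvent_vec A) = resolvent_vec A.
  by apply/mxOverP => i j; rewrite real_polyE -{2}hJ [X in _ == X]mxE.
rewrite map_mxZ map_mxM /= map_mx_adj map_char_poly_mx map_char_poly.
rewrite realmx_conj //.
by congr (_ *: (_ *m _)); apply/colP => j; rewrite !mxE rmorph1.
Qed.

End RealPolynomialVectors.

(** * Subinvariant vectors *)

Lemma exists_multiple_ge (R : numFieldType) (I : finType) (P : {pred I})
    (c d : I -> R) :
    (forall i, 0 <= c i) -> {in P, forall i, 0 < d i} ->
  exists2 t, 0 < t & {in P, forall i, c i <= t * d i}.
Proof.
move=> c_ge0 d_gt0; have q_ge0 i : i \in P -> 0 <= c i / d i.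
  by move=> /d_gt0/ltW; apply: divr_ge0.
exists (1 + \sum_(i in P) c i / d i) => [|i iP].
  by rewrite ltr_pwDl ?sumr_ge0.
rewrite -ler_pdivrMr ?d_gt0 // (bigD1 i) //= addrCA lerDl.
rewrite addr_ge0 ?sumr_ge0 //.
by move=> j /andP[/q_ge0].
Qed.

Section OrderedVectors.
Variables (C : numClosedFieldType) (n : nat).
Implicit Types x y : 'cV[C]_n.

Lemma pos_vecW x : pos_vec x -> nonneg_vec x.
Proof. by move=> x_gt0 i; apply: ltW. Qed.

Lemma nonneg_vec_real x : nonneg_vec x -> x \is a realmx.
Proof. by move=> x_ge0; apply/mxOverP => i j; rewrite ord1 ger0_real. Qed.

Lemma min_ratio x y (k : 'I_n) : x \is a realmx -> pos_vec y ->
  exists t, [/\ t \is Num.real, nonneg_vec (x - t *: y) &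
                exists i, x i 0 = t * y i 0].
Proof.
move=> /mxOverP xR y_gt0.
have ratioR i : x i 0 / y i 0 \is Num.real by rewrite rpred_div // gtr0_real.
case: (@real_arg_minP _ _ k xpredT (fun i => x i 0 / y i 0)) => // i _ i_min.
exists (x i 0 / y i 0); split=> // [j|].
  by rewrite !mxE subr_ge0 -ler_pdivlMr // i_min.
by exists i; rewrite divfK ?gt_eqF.
Qed.

End OrderedVectors.

Section SubinvariantVectors.
Variables (C : numClosedFieldType) (n : nat) (A : 'M[C]_n).
Implicit Types (x y v : 'cV[C]_n) (r l s : C).

Definition subinvariant r x := forall i, (A *m x) i 0 <= r * x i 0.
Definition superinvariant r x := forall i, r * x i 0 <= (A *m x) i 0.
Definition strictly_subinvariant r x := forall i, (A *m x) i 0 < r * x i 0.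

Lemma eigenvector_subinvariant r x : A *m x = r *: x -> subinvariant r x.
Proof. by move=> Ax i; rewrite Ax mxE. Qed.

Lemma eigenvector_superinvariant r x : A *m x = r *: x -> superinvariant r x.
Proof. by move=> Ax i; rewrite Ax mxE. Qed.

Lemma strictly_subinvariantW r x :
  strictly_subinvariant r x -> subinvariant r x.
Proof. by move=> Ax i; apply: ltW. Qed.

Lemma const_strictly_subinvariant x l c :
  0 < c -> l *: x - A *m x = const_mx c -> strictly_subinvariant l x.
Proof.
by move=> c_gt0 /colP xE i; have := xE i; rewrite -subr_gt0 !mxE => ->.
Qed.

End SubinvariantVectors.

Section NonnegativeMatrix.
Variables (C : numClosedFieldType) (n : nat) (A : 'M[C]_n).
Hypothesis A_ge0 : nonneg_mx A.
Implicit Types (x y v : 'cV[C]_n) (r l s : C).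

Lemma nonneg_mx_real : A \is a realmx.
Proof. by apply/mxOverP => i j; rewrite ger0_real. Qed.

Lemma nonneg_mulmx x : nonneg_vec x -> nonneg_vec (A *m x).
Proof. by move=> x_ge0 i; rewrite mxE sumr_ge0 // => j _; rewrite mulr_ge0. Qed.

Lemma ler_mulmx x y i : nonneg_vec (y - x) -> (A *m x) i 0 <= (A *m y) i 0.
Proof. by move/nonneg_mulmx/(_ i); rewrite mulmxBr !mxE subr_ge0. Qed.

Lemma strictly_subinvariant_pos r x :
  nonneg_vec x -> strictly_subinvariant A r x -> pos_vec x.
Proof.
move=> x_ge0 x_sub i; rewrite lt_def x_ge0 andbT.
by apply: contraTneq (x_sub i) => ->; rewrite mulr0 le_gtF ?nonneg_mulmx.
Qed.

(* That is, (r - A) v >= 0 implies v >= 0: r - A is an M-matrix. *)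
Lemma strictly_subinvariant_monotone r x v :
    pos_vec x -> strictly_subinvariant A r x ->
    v \is a realmx -> subinvariant A r v ->
  nonneg_vec v.
Proof.
move=> x_gt0 x_sub vR v_sub k.
have [t [tR vtx_ge0 [i vi]]] := min_ratio k vR x_gt0.
have [t_ge0|t_lt0] := real_leP (real0 C) tR.
  rewrite (le_trans (mulr_ge0 t_ge0 (ltW (x_gt0 k)))) //.
  by have := vtx_ge0 k; rewrite !mxE subr_ge0.
have := le_trans (ler_mulmx i vtx_ge0) (v_sub i).
by rewrite -scalemxAr mxE vi mulrCA ler_nM2l // lt_geF.
Qed.

Lemma superinvariant_exists_le s x y :
    pos_vec x -> nonneg_vec y -> y != 0 -> superinvariant A s y ->
  exists i, s * x i 0 <= (A *m x) i 0.
Proof.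
move=> x_gt0 y_ge0 /cV0Pn[k yk] y_super.
have yR : - y \is a realmx.
  by apply/mxOverP => i j; rewrite ord1 mxE rpredN ger0_real.
have [u [_ uxy_ge0 [i yi]]] := min_ratio k yR x_gt0.
pose t := - u; have {}yi : y i 0 = t * x i 0 by rewrite mulNr -yi mxE opprK.
have {uxy_ge0} txy_ge0 : nonneg_vec (t *: x - y) by rewrite scaleNr addrC.
have t_gt0 : 0 < t.
  rewrite -(pmulr_lgt0 _ (x_gt0 k)); apply: (@lt_le_trans _ _ (y k 0)).
    by rewrite lt_def yk y_ge0.
  by have := txy_ge0 k; rewrite !mxE subr_ge0.
exists i; have := le_trans (y_super i) (ler_mulmx i txy_ge0).
by rewrite -scalemxAr mxE yi mulrCA ler_pM2l.
Qed.

Lemma normr_eigenvector_superinvariant l z :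
  A *m z = l *: z -> superinvariant A `|l| (map_mx Num.norm z).
Proof.
move=> Az i; rewrite mxE -normrM.
have -> : l * z i 0 = (A *m z) i 0 by rewrite Az mxE.
rewrite !mxE; apply: le_trans (ler_norm_sum _ _ _) _.
by apply: ler_sum => j _; rewrite normrM mxE ger0_norm.
Qed.

End NonnegativeMatrix.

(** * The spectral radius of a nonnegative matrix *)

Lemma eigenvalue_colP (F : fieldType) (n : nat) (A : 'M[F]_n) (l : F) :
  reflect (exists2 z : 'cV_n, A *m z = l *: z & z != 0) (eigenvalue A l).
Proof.
have -> : eigenvalue A l = eigenvalue A^T l.
  rewrite /eigenvalue !kermx_eq0 !row_free_unit -unitmx_tr linearB /=.
  by rewrite tr_scalar_mx.
apply: (iffP eigenvalueP) => [[u uA u0]|[z Az z0]].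
  by exists u^T; rewrite ?trmx_eq0 // -[A]trmxK -trmx_mul uA linearZ.
by exists z^T; rewrite ?trmx_eq0 // -trmx_mul Az linearZ.
Qed.

Lemma spec_radP (C : numClosedFieldType) (n : nat) (A : 'M[C]_n) :
  (0 < n)%N -> is_spec_rad A (spec_rad A).
Proof.
move=> n_gt0; apply: epsilon_spec.
have [s rootE] := poly_roots_seq (monic_neq0 (char_poly_monic A)).
have eigenvalueE l : eigenvalue A l = (l \in s).
  by rewrite eigenvalue_root_char rootE.
have [l1] := eigenvalue_closed A n_gt0; rewrite eigenvalueE => l1s.
have normR (l : seq_sub s) : `|val l| \is Num.real := normr_real (val l).
case: (@real_arg_maxP _ _ (SeqSub l1s) xpredT _ isT (fun l _ => normR l)).
move=> l _ l_max; exists `|val l|; split=> [|t].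
  by exists (val l); rewrite eigenvalueE (valP l).
by rewrite eigenvalueE => ts; apply: (l_max (SeqSub ts)).
Qed.

Lemma spec_rad_ge0 (C : numClosedFieldType) (n : nat) (A : 'M[C]_n) :
  (0 < n)%N -> 0 <= spec_rad A.
Proof. by move=> n_gt0; have [[l [_ <-]] _] := spec_radP A n_gt0. Qed.

Section Perron.
Variables (C : numClosedFieldType) (n : nat) (A : 'M[C]_n).
Hypotheses (n_gt0 : (0 < n)%N) (A_ge0 : nonneg_mx A).
Implicit Types (x y : 'cV[C]_n) (l r : C).
Local Notation rho := (spec_rad A).
Local Notation h := (resolvent_vec A).

Lemma spec_rad_exists_le x : pos_vec x -> exists i, rho * x i 0 <= (A *m x) i 0.
Proof.
move=> x_gt0; have [[l [/eigenvalue_colP[z Az z0] <-]] _] := spec_radP A n_gt0.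
apply: (@superinvariant_exists_le _ _ A A_ge0 _ _ (map_mx Num.norm z)) => //.
- by move=> i; rewrite mxE.
- by case/cV0Pn: z0 => i zi; apply/cV0Pn; exists i; rewrite mxE normr_eq0.
exact: normr_eigenvector_superinvariant.
Qed.

Lemma spec_rad_le_subinvariant r x :
  pos_vec x -> subinvariant A r x -> rho <= r.
Proof.
move=> x_gt0 x_sub; have [i] := spec_rad_exists_le x_gt0.
by move/le_trans/(_ (x_sub i)); rewrite ler_pM2r.
Qed.

Lemma spec_rad_lt_strictly_subinvariant r x :
  nonneg_vec x -> strictly_subinvariant A r x -> rho < r.
Proof.
move=> x_ge0 x_sub; have x_gt0 := strictly_subinvariant_pos A_ge0 x_ge0 x_sub.
have [i] := spec_rad_exists_le x_gt0.
by move/le_lt_trans/(_ (x_sub i)); rewrite ltr_pM2r.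
Qed.

Let pR : char_poly A \is a polyOver Num.real :=
  char_poly_real (nonneg_mx_real A_ge0).

Let hR : h \is a mxOver (polyOver Num.real) :=
  resolvent_vec_real (nonneg_mx_real A_ge0).

Lemma spec_rad_real : rho \is Num.real.
Proof. by rewrite ger0_real // spec_rad_ge0. Qed.

Lemma gt_spec_rad_real l : rho < l -> l \is Num.real.
Proof. by move/ltW/ler_real <-; apply: spec_rad_real. Qed.

Lemma gt_spec_rad_not_root l : rho < l -> ~~ root (char_poly A) l.
Proof.
move=> lt_rl; rewrite -eigenvalue_root_char.
apply/negP => /(spec_radP A n_gt0).2.
by rewrite ger0_norm ?(le_trans (spec_rad_ge0 A n_gt0)) ?(ltW lt_rl) // lt_geF.
Qed.

Lemma resolvent_vec_strictly_subinvariant l : rho < l ->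
  strictly_subinvariant A l (horner_vec h l).
Proof.
move=> lt_rl; have pl := gt_spec_rad_not_root lt_rl.
apply: const_strictly_subinvariant (horner_mul_char_poly_mx_resolvent A l).
by rewrite real_exprn_even_gt0 // rpred_horner ?pR ?gt_spec_rad_real.
Qed.

Lemma ones_strictly_subinvariant l :
  \sum_i \sum_j A i j < l -> strictly_subinvariant A l (const_mx 1).
Proof.
move=> lt_sum_l i; rewrite !mxE mulr1; under eq_bigr do rewrite mxE mulr1.
apply: le_lt_trans lt_sum_l; rewrite [leRHS](bigD1 i) //= lerDl.
by apply: sumr_ge0 => k _; apply: sumr_ge0.
Qed.

Lemma resolvent_vec_gt0_large l : l \is Num.real ->
  exists2 b, l <= b & pos_vec (horner_vec h b).
Proof.
move=> lR; pose L := \sum_i \sum_j A i j; pose b := `|l| + (L + 1).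
have L_ge0 : 0 <= L by apply: sumr_ge0 => i _; apply: sumr_ge0.
have ones_sub : strictly_subinvariant A b (const_mx 1).
  by apply: ones_strictly_subinvariant; rewrite ltr_wpDl // ltrDl.
have ones_gt0 : pos_vec (const_mx 1 : 'cV[C]_n) by move=> i; rewrite mxE.
have lt_rb := spec_rad_lt_strictly_subinvariant (pos_vecW ones_gt0) ones_sub.
exists b; first by rewrite (le_trans (real_ler_norm lR)) // lerDl addr_ge0.
have b_sub := resolvent_vec_strictly_subinvariant lt_rb.
apply: (strictly_subinvariant_pos A_ge0 _ b_sub).
apply: (strictly_subinvariant_monotone A_ge0 ones_gt0 ones_sub).
  exact: horner_vec_real hR (gt_spec_rad_real lt_rb).
exact: strictly_subinvariantW.
Qed.

Lemma resolvent_vec_gt0 l : rho < l -> pos_vec (horner_vec h l).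
Proof.
move: l; apply: horner_vec_gt0_right hR spec_rad_real _ _.
  exact: resolvent_vec_gt0_large.
move=> l lt_rl h_ge0; apply: (strictly_subinvariant_pos A_ge0 h_ge0).
exact: resolvent_vec_strictly_subinvariant.
Qed.

Lemma exists_strictly_subinvariant l : rho < l ->
  exists2 x, pos_vec x & strictly_subinvariant A l x.
Proof.
move=> lt_rl; exists (horner_vec h l).
  exact: resolvent_vec_gt0.
exact: resolvent_vec_strictly_subinvariant.
Qed.

(* The eigenvector is the first nonzero coefficient of the resolvent vector in
   powers of X - rho. *)
Lemma perron_vector :
  exists y, [/\ nonneg_vec y, y != 0 & A *m y = rho *: y].
Proof.
have h0 : h != 0.
  have [|b _ b_gt0] := @resolvent_vec_gt0_large 0; first exact: real0.
  apply/negP => /eqP h0; have := b_gt0 (Ordinal n_gt0).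
  by rewrite h0 horner_vecE mxE horner0 ltxx.
have h_ge0 l : rho < l -> nonneg_vec (horner_vec h l).
  by move=> lt_rl; apply/pos_vecW/resolvent_vec_gt0.
have [k [g [hE gR g_ge0 g0]]] :=
  real_poly_vec_factor_XsubC hR spec_rad_real h0 h_ge0.
set d := ('X - rho%:P) ^+ k in hE.
pose S := (char_poly_mx A *m g) (Ordinal n_gt0) 0.
have d0 : d != 0 by rewrite expf_neq0 // polyXsubC_eq0.
have dS i : d * (char_poly_mx A *m g) i 0 = char_poly A ^+ 2.
  have /colP/(_ i) := mul_char_poly_mx_resolvent A.
  by rewrite hE -scalemxAr [LHS]mxE [RHS]mxE.
have dR : d \is a polyOver Num.real.
  by rewrite real_polyX // polyOverXsubC spec_rad_real.
have S_ge0 : 0 <= S.[rho].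
  apply: real_poly_ge0_right spec_rad_real _ => [|l lt_rl].
    by apply: real_poly_mulIr d0 dR _; rewrite mulrC dS real_polyX ?pR.
  have d_gt0 : 0 < d.[l].
    by rewrite horner_exp hornerXsubC exprn_gt0 // subr_gt0.
  rewrite -(pmulr_rge0 _ d_gt0) -hornerM dS horner_exp real_exprn_even_ge0 //.
  by rewrite rpred_horner ?pR ?gt_spec_rad_real.
have gE : rho *: horner_vec g rho - A *m horner_vec g rho = const_mx S.[rho].
  rewrite -horner_mul_char_poly_mx; apply/colP => i.
  rewrite horner_vecE [RHS]mxE.
  by congr _.[rho]; apply: (mulfI d0); rewrite !dS.
exists (horner_vec g rho); split=> //; apply/esym/eqP; rewrite -subr_eq0 gE.
have [->|S0] := eqVneq S.[rho] 0; first by apply/eqP/colP => i; rewrite !mxE.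
have S_gt0 : 0 < S.[rho] by rewrite lt_def S0.
have g_sub := const_strictly_subinvariant S_gt0 gE.
by have := spec_rad_lt_strictly_subinvariant g_ge0 g_sub; rewrite ltxx.
Qed.

End Perron.

Lemma superinvariant_le_spec_rad (C : numClosedFieldType) (n : nat)
    (A : 'M[C]_n) (s : C) (y : 'cV[C]_n) :
    nonneg_mx A -> nonneg_vec y -> y != 0 -> superinvariant A s y ->
  s <= spec_rad A.
Proof.
move=> A_ge0 y_ge0 y0 y_super; have [k _] := cV0Pn _ y0.
have n_gt0 : (0 < n)%N by apply: leq_ltn_trans (ltn_ord k).
apply/ler_addgt0Pr => e e_gt0.
have lt_r_re : spec_rad A < spec_rad A + e by rewrite ltrDl.
have [x x_gt0 x_sub] := exists_strictly_subinvariant n_gt0 A_ge0 lt_r_re.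
have [i] := superinvariant_exists_le A_ge0 x_gt0 y_ge0 y0 y_super.
by move/le_lt_trans/(_ (x_sub i)); rewrite ltr_pM2r // => /ltW.
Qed.

(** * Irreducible matrices *)

Section Reachability.
Variables (C : numClosedFieldType) (m : nat) (A : 'M[C]_m).
Implicit Types (W : {set 'I_m}) (i j : 'I_m).

Definition reach : rel 'I_m := connect (edge_in A setT).

Lemma reach_refl : reflexive reach.
Proof. exact: connect0. Qed.

Lemma reach_trans : transitive reach.
Proof. exact: connect_trans. Qed.

Lemma reach_edge i j : 0 < A i j -> reach i j.
Proof. by move=> Aij; apply: connect1; rewrite /edge_in /= !inE. Qed.

Lemma connect_edge_in_reach W i j : connect (edge_in A W) i j -> reach i j.
Proof. by apply: connect_sub => a b /andP[_ /reach_edge]. Qed.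

Lemma irreducible_reach i j : irreducible_mx A -> reach i j.
Proof. by move=> irrA; apply: irrA; rewrite inE. Qed.

End Reachability.

Section Irreducible.
Variables (C : numClosedFieldType) (n : nat) (A : 'M[C]_n).
Hypothesis A_ge0 : nonneg_mx A.
Implicit Types (x y : 'cV[C]_n) (r : C) (i j : 'I_n).

Lemma subinvariant_reach_gt0 r x i j :
    nonneg_vec x -> subinvariant A r x -> reach A i j -> 0 < x j 0 ->
  0 < x i 0.
Proof.
move=> x_ge0 x_sub /connectP[p].
elim: p i => [|k p IH] i /=; first by move=> _ ->.
case/andP=> /andP[_ Aik] path_p last_p /(IH k path_p last_p) xk_gt0.
rewrite lt_def x_ge0 andbT; apply: contraTneq (x_sub i) => ->.
rewrite mulr0 mxE lt_geF // (bigD1 k) //= ltr_pwDl ?mulr_gt0 //.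
by apply: sumr_ge0 => l _; apply: mulr_ge0.
Qed.

Hypothesis A_irr : irreducible_mx A.

Lemma irreducible_subinvariant_gt0 r x :
  nonneg_vec x -> x != 0 -> subinvariant A r x -> pos_vec x.
Proof.
move=> x_ge0 /cV0Pn[j xj] x_sub i.
apply: (subinvariant_reach_gt0 x_ge0 x_sub (irreducible_reach i j A_irr)).
by rewrite lt_def xj x_ge0.
Qed.

(* Subtract from x the largest multiple of y that keeps it nonnegative: the
   difference is subinvariant and vanishes somewhere, hence everywhere. *)
Lemma irreducible_subinvariant_collinear r x y :
    x \is a realmx -> subinvariant A r x -> pos_vec y -> A *m y = r *: y ->
  exists t, x = t *: y.
Proof.
move=> xR x_sub y_gt0 Ay; have [->|/cV0Pn[k _]] := eqVneq x 0.
  by exists 0; rewrite scale0r.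
have [t [_ d_ge0 [i xi]]] := min_ratio k xR y_gt0.
exists t; apply/eqP; rewrite -subr_eq0; apply: contraT => d0.
have d_sub : subinvariant A r (x - t *: y).
  move=> j; have := x_sub j.
  by rewrite mulmxBr -scalemxAr Ay !mxE mulrBr mulrCA lerD2r.
have := irreducible_subinvariant_gt0 d_ge0 d0 d_sub i.
by rewrite !mxE xi subrr ltxx.
Qed.

Hypothesis n_gt0 : (0 < n)%N.

Lemma irreducible_perron_vector :
  exists2 y, pos_vec y & A *m y = spec_rad A *: y.
Proof.
have [y [y_ge0 y0 Ay]] := perron_vector n_gt0 A_ge0; exists y => //.
exact: irreducible_subinvariant_gt0 y_ge0 y0 (eigenvector_subinvariant Ay).
Qed.

Lemma irreducible_subinvariant_eigenvector x :
    x \is a realmx -> subinvariant A (spec_rad A) x ->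
  A *m x = spec_rad A *: x.
Proof.
move=> xR x_sub; have [y y_gt0 Ay] := irreducible_perron_vector.
have [t ->] := irreducible_subinvariant_collinear xR x_sub y_gt0 Ay.
by rewrite -scalemxAr Ay !scalerA mulrC.
Qed.

Lemma irreducible_subinvariant_unique x1 x2 :
    x1 \is a realmx -> \sum_i x1 i 0 = 1 -> subinvariant A (spec_rad A) x1 ->
    x2 \is a realmx -> \sum_i x2 i 0 = 1 -> subinvariant A (spec_rad A) x2 ->
  x1 = x2.
Proof.
move=> x1R sum1 x1_sub x2R sum2 x2_sub.
have [y y_gt0 Ay] := irreducible_perron_vector.
have sum_scale t : \sum_i (t *: y) i 0 = t * \sum_i y i 0.
  by rewrite mulr_sumr; apply: eq_bigr => i _; rewrite mxE.
have [t1 x1E] := irreducible_subinvariant_collinear x1R x1_sub y_gt0 Ay.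
have [t2 x2E] := irreducible_subinvariant_collinear x2R x2_sub y_gt0 Ay.
move: sum1 sum2; rewrite {}x1E {}x2E !sum_scale => sum1 sum2; congr (_ *: _).
apply: (@mulIf _ (\sum_i y i 0)); last by rewrite sum1.
by apply: contra_eq_neq sum1 => ->; rewrite mulr0 eq_sym oner_eq0.
Qed.

End Irreducible.

(** * Principal submatrices *)

Lemma forall_in_enum_val (T : finType) (U : {set T}) (P : T -> Prop) :
  (forall k : 'I_#|U|, P (enum_val k)) -> {in U, forall i, P i}.
Proof. by move=> P_enum i iU; rewrite -(enum_rankK_in iU iU). Qed.

Section PadVector.
Variables (R : nmodType) (m : nat) (U : {set 'I_m}).

Definition pad_vec (z : 'cV[R]_#|U|) : 'cV[R]_m :=
  \col_i \sum_(k | enum_val k == i) z k 0.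

Lemma pad_vec_enum_val z k : pad_vec z (enum_val k) 0 = z k 0.
Proof. by rewrite mxE (big_pred1 k) // => l; rewrite (inj_eq enum_val_inj). Qed.

Lemma pad_vecK : cancel pad_vec (rowsub enum_val).
Proof. by move=> z; apply/colP => k; rewrite mxE pad_vec_enum_val. Qed.

Lemma pad_vec_out z i : i \notin U -> pad_vec z i 0 = 0.
Proof.
by move=> iU; rewrite mxE big1 // => k /eqP ki; rewrite -ki enum_valP in iU.
Qed.

Lemma pad_vec_neq0 z : z != 0 -> pad_vec z != 0.
Proof.
apply: contraNneq => z0; rewrite -[z]pad_vecK z0.
by apply/eqP/colP => k; rewrite !mxE.
Qed.

End PadVector.

Section PrincipalSubmatrix.
Variables (C : numClosedFieldType) (m : nat) (A : 'M[C]_m) (U : {set 'I_m}).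
Implicit Types (x : 'cV[C]_m) (z : 'cV[C]_#|U|) (r s : C).

Lemma mulmx_psubmx x k :
  (A *m x) (enum_val k) 0 = (psubmx A U *m rowsub enum_val x) k 0
                            + \sum_(j | j \notin U) A (enum_val k) j * x j 0.
Proof.
rewrite !mxE (bigID (mem U)) /= big_enum_val; congr (_ + _).
by apply: eq_bigr => j _; rewrite !mxE.
Qed.

Lemma mulmx_pad_vec z k :
  (A *m pad_vec z) (enum_val k) 0 = (psubmx A U *m z) k 0.
Proof.
rewrite mulmx_psubmx pad_vecK big1 ?addr0 // => j jU.
by rewrite pad_vec_out // mulr0.
Qed.

Lemma pad_vec_gt0 z : pos_vec z -> {in U, forall i, 0 < pad_vec z i 0}.
Proof.
by move=> z_gt0; apply: forall_in_enum_val => k; rewrite pad_vec_enum_val.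
Qed.

Lemma pad_vec_ge0 z : nonneg_vec z -> nonneg_vec (pad_vec z).
Proof. by move=> z_ge0 i; rewrite mxE sumr_ge0. Qed.

Lemma rowsub_ge0 x : nonneg_vec x -> nonneg_vec (rowsub enum_val x : 'cV_#|U|).
Proof. by move=> x_ge0 k; rewrite mxE. Qed.

Lemma psubmx_irreducible :
  strongly_connected_on A U -> irreducible_mx (psubmx A U).
Proof.
move=> U_conn i j _ _.
have /connectP[p] := U_conn _ _ (enum_valP i) (enum_valP j).
elim: p i => [|a p IH] i /=; first by move=> _ /enum_val_inj ->.
case/andP=> /andP[/andP[_ aU] A_ia] path_p last_p.
rewrite -(enum_rankK_in aU aU) in A_ia path_p last_p.
apply: connect_trans (IH _ path_p last_p); apply: connect1.
by rewrite /edge_in /= !inE mxE.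
Qed.

Hypothesis A_ge0 : nonneg_mx A.

Lemma psubmx_ge0 : nonneg_mx (psubmx A U).
Proof. by move=> i j; rewrite mxE. Qed.

Lemma rowsub_subinvariant r x : nonneg_vec x ->
  subinvariant A r x -> subinvariant (psubmx A U) r (rowsub enum_val x).
Proof.
move=> x_ge0 x_sub k; rewrite [rowsub _ _ _ _]mxE.
apply: le_trans (x_sub _); rewrite mulmx_psubmx lerDl.
by apply: sumr_ge0 => j _; apply: mulr_ge0.
Qed.

Lemma pad_vec_superinvariant s z : nonneg_vec z ->
  superinvariant (psubmx A U) s z -> superinvariant A s (pad_vec z).
Proof.
move=> z_ge0 z_super.
have U_super : {in U, forall i, s * pad_vec z i 0 <= (A *m pad_vec z) i 0}.
  by apply: forall_in_enum_val => k; rewrite mulmx_pad_vec pad_vec_enum_val.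
move=> i; have [/U_super//|iU] := boolP (i \in U).
by rewrite pad_vec_out // mulr0; apply/nonneg_mulmx/pad_vec_ge0.
Qed.

Lemma spec_rad_psubmx_le : U != set0 -> spec_rad (psubmx A U) <= spec_rad A.
Proof.
rewrite -card_gt0 => U_gt0.
have [z [z_ge0 z0 Az]] := perron_vector U_gt0 psubmx_ge0.
apply: superinvariant_le_spec_rad (pad_vec_ge0 z_ge0) (pad_vec_neq0 z0) _ => //.
exact: pad_vec_superinvariant z_ge0 (eigenvector_superinvariant Az).
Qed.

End PrincipalSubmatrix.

(** * Strongly connected components *)

Section Components.
Variables (C : numClosedFieldType) (m : nat) (A : 'M[C]_m).
Implicit Types (V W : {set 'I_m}) (i j k : 'I_m).

Definition scc_of i : {set 'I_m} := [set j | reach A i j && reach A j i].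

Lemma scc_of_refl i : i \in scc_of i.
Proof. by rewrite inE !reach_refl. Qed.

Lemma scc_of_neq0 i : scc_of i != set0.
Proof. by apply/set0Pn; exists i; apply: scc_of_refl. Qed.

Lemma scc_of_eq i j : j \in scc_of i -> scc_of j = scc_of i.
Proof.
rewrite inE => /andP[ij ji]; apply/setP => k; rewrite !inE.
apply/andP/andP => -[a b]; split.
- exact: reach_trans ij a.
- exact: reach_trans b ji.
- exact: reach_trans ji a.
- exact: reach_trans b ij.
Qed.

Lemma card_scc_of_gt0 i : (0 < #|scc_of i|)%N.
Proof. by rewrite card_gt0 scc_of_neq0. Qed.

Lemma scc_of_connected i : strongly_connected_on A (scc_of i).
Proof.
move=> j k; rewrite !inE => /andP[ij ji] /andP[ik ki].
have /connectP[p] := reach_trans ji ik; elim: p j ij ji => [|l p IH] j ij ji /=.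
  by move=> _ ->; apply: connect0.
case/andP=> /andP[_ Ajl] path_p last_p.
have il : reach A i l := reach_trans ij (reach_edge Ajl).
have lk : reach A l k by apply/connectP; exists p.
have li : reach A l i := reach_trans lk ki.
apply: connect_trans (IH l il li path_p last_p); apply: connect1.
by rewrite /edge_in /= !inE ij ji il li.
Qed.

Lemma strongly_connected_sub_scc_of W i :
  strongly_connected_on A W -> i \in W -> W \subset scc_of i.
Proof.
move=> W_conn iW; apply/subsetP => j jW.
by rewrite inE !(@connect_edge_in_reach _ _ _ W) ?W_conn.
Qed.

Lemma is_sccP V : is_scc A V <-> exists i, V = scc_of i.
Proof.
split=> [[/set0Pn[i iV] [V_conn V_max]]|[i ->]].
  exists i; apply/esym/V_max; last exact: scc_of_connected.
  exact: strongly_connected_sub_scc_of.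
split; first exact: scc_of_neq0.
split=> [|W sub_iW W_conn]; first exact: scc_of_connected.
apply/eqP; rewrite eqEsubset sub_iW andbT strongly_connected_sub_scc_of //.
exact: (subsetP sub_iW) (scc_of_refl i).
Qed.

Lemma edge_betweenPn V W :
  reflect (forall a b, a \in V -> b \in W -> ~~ (0 < A a b))
          (~~ edge_between A V W).
Proof.
apply: (iffP idP) => [noedge a b aV bW|noedge].
  apply: contra noedge => Aab; apply/exists_inP; exists a => //.
  by apply/exists_inP; exists b.
by apply/exists_inP => -[a aV /exists_inP[b bW]]; apply/negP/noedge.
Qed.

Lemma scc_of_closedP (e : rel 'I_m) i :
  (forall a b, a \in scc_of i -> e a b -> b \in scc_of i) <->
  (forall W, is_scc A W -> W != scc_of i ->
     forall a b, a \in scc_of i -> b \in W -> ~~ e a b).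
Proof.
split=> [closed _ /is_sccP[c ->] neq a b ai bc|no_edge a b ai].
  apply: contraNN neq => /(closed a b ai) bi.
  by rewrite -(scc_of_eq bc) (scc_of_eq bi).
apply: contraTT => bi; apply: (no_edge (scc_of b)) => //.
- by apply/is_sccP; exists b.
- by apply: contraNneq bi => <-; apply: scc_of_refl.
exact: scc_of_refl.
Qed.

Lemma is_sinkP i :
  is_sink A (scc_of i) <->
  forall a b, a \in scc_of i -> 0 < A a b -> b \in scc_of i.
Proof.
rewrite (scc_of_closedP (fun a b => 0 < A a b)).
by split=> sink W W_scc neq; apply/edge_betweenPn/sink.
Qed.

Lemma is_sourceP i :
  is_source A (scc_of i) <->
  forall a b, b \in scc_of i -> 0 < A a b -> a \in scc_of i.
Proof.
have closedP := scc_of_closedP (fun b a => 0 < A a b) i.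
split=> [source a b|closed W W_scc neq].
  apply: closedP.2 => W W_scc neq c d ci dW.
  by have /edge_betweenPn := source W W_scc neq; apply.
apply/edge_betweenPn => a b aW bi; apply: closedP.1 W_scc neq b a bi aW => c d.
exact: closed.
Qed.

End Components.

Lemma preorder_maximal (T : finType) (e : rel T) (Y : {set T}) :
    reflexive e -> transitive e -> Y != set0 ->
  exists2 i, i \in Y & forall j, j \in Y -> e i j -> e j i.
Proof.
move=> e_refl e_trans /set0Pn[y yY]; pose up i := [set k in Y | e i k].
case: (@arg_minnP _ y (mem Y) (fun i => #|up i|) yY) => i iY i_min.
exists i => // j jY eij.
have sub_ji : up j \subset up i.
  by apply/subsetP => k; rewrite !inE => /andP[-> /(e_trans _ _ _ eij)].
have /eqP/setP/(_ i) : up j == up i by rewrite eqEcard sub_ji i_min.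
by rewrite !inE (iY : i \in Y) e_refl /= => ->.
Qed.

(** * Classes and the spectral radius *)

Section ComponentSpectralRadius.
Variables (C : numClosedFieldType) (m : nat) (A : 'M[C]_m).
Hypothesis A_ge0 : nonneg_mx A.
Implicit Types (V S T : {set 'I_m}) (x y : 'cV[C]_m) (r s : C) (i j : 'I_m).

Definition scc_spec_rad i : C := spec_rad (psubmx A (scc_of A i)).

Lemma scc_spec_rad_ge0 i : 0 <= scc_spec_rad i.
Proof. exact/spec_rad_ge0/card_scc_of_gt0. Qed.

Lemma scc_spec_rad_le i : scc_spec_rad i <= spec_rad A.
Proof. exact/spec_rad_psubmx_le/scc_of_neq0. Qed.

Lemma scc_perron_vector i :
  exists x, [/\ nonneg_vec x,
                {in scc_of A i, forall a, 0 < x a 0},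
                forall a, a \notin scc_of A i -> x a 0 = 0 &
                {in scc_of A i, forall a,
                   (A *m x) a 0 = scc_spec_rad i * x a 0}].
Proof.
have V_gt0 := card_scc_of_gt0 A i.
have V_irr := psubmx_irreducible (@scc_of_connected _ _ A i).
have [z z_gt0 Az] := irreducible_perron_vector (psubmx_ge0 A_ge0) V_irr V_gt0.
exists (pad_vec z); split.
- exact/pad_vec_ge0/pos_vecW.
- exact: pad_vec_gt0.
- exact: pad_vec_out.
apply: forall_in_enum_val => k.
by rewrite mulmx_pad_vec pad_vec_enum_val Az mxE.
Qed.

Lemma subinvariant_no_exit V x :
    strongly_connected_on A V -> pos_vec x ->
    subinvariant A (spec_rad (psubmx A V)) x ->
  forall a b, a \in V -> 0 < A a b -> b \in V.
Proof.
move=> V_conn x_gt0 x_sub a b aV; move: a aV b.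
apply: forall_in_enum_val => k b A_kb; apply: contraT => bV.
have V_gt0 : (0 < #|V|)%N by apply: leq_ltn_trans (ltn_ord k).
have V_irr := psubmx_irreducible V_conn; have x_ge0 := pos_vecW x_gt0.
have xR := nonneg_vec_real (rowsub_ge0 (U := V) x_ge0).
have x_subV := rowsub_subinvariant (U := V) A_ge0 x_ge0 x_sub.
have /colP/(_ k) := irreducible_subinvariant_eigenvector
  (psubmx_ge0 A_ge0) V_irr V_gt0 xR x_subV.
rewrite [RHS]mxE [rowsub _ _ _ _]mxE => Axk.
have := x_sub (enum_val k); rewrite mulmx_psubmx Axk gerDl lt_geF //.
rewrite (bigD1 b) //= ltr_pwDl ?mulr_gt0 //.
by apply: sumr_ge0 => j _; apply: mulr_ge0.
Qed.

(* Take a class of the support of y from which no other class of the support is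
   reachable. *)
Lemma superinvariant_le_scc_spec_rad s y :
    nonneg_vec y -> y != 0 -> superinvariant A s y ->
  exists2 i, y i 0 != 0 & s <= scc_spec_rad i.
Proof.
move=> y_ge0 /cV0Pn[j yj] y_super; pose Y := [set i | y i 0 != 0].
have Y0 : Y != set0 by apply/set0Pn; exists j; rewrite inE.
have [i] := preorder_maximal (@reach_refl _ _ A) (@reach_trans _ _ A) Y0.
rewrite inE => yi i_max; exists i => //.
apply: (superinvariant_le_spec_rad (psubmx_ge0 A_ge0) (rowsub_ge0 y_ge0)).
- have ii := scc_of_refl A i; apply/cV0Pn; exists (enum_rank_in ii i).
  by rewrite mxE enum_rankK_in.
move=> k; rewrite [rowsub _ _ _ _]mxE; have := y_super (enum_val k).
rewrite mulmx_psubmx big1 ?addr0 // => b bV; apply/eqP.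
apply: contraNT bV; rewrite mulf_eq0 negb_or => /andP[A_kb yb].
have ib : reach A i b.
  have := enum_valP k; rewrite inE => /andP[ik _]; apply: reach_trans ik _.
  by apply: reach_edge; rewrite lt_def A_kb A_ge0.
by rewrite inE ib i_max // inE.
Qed.

Lemma spec_rad_psubmx_lt T r : T != set0 ->
  {in T, forall i, scc_spec_rad i < r} -> spec_rad (psubmx A T) < r.
Proof.
rewrite -card_gt0 => T_gt0 T_lt.
have [z [z_ge0 z0 Az]] := perron_vector T_gt0 (psubmx_ge0 A_ge0).
have [i zi] := superinvariant_le_scc_spec_rad
  (pad_vec_ge0 z_ge0) (pad_vec_neq0 z0)
  (pad_vec_superinvariant A_ge0 z_ge0 (eigenvector_superinvariant Az)).
by move/le_lt_trans; apply; apply: T_lt; apply: contraNT zi => /pad_vec_out->.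
Qed.

Lemma sink_classes_eigenvector S r :
    {in S, forall i, [/\ scc_of A i \subset S, is_sink A (scc_of A i)
                       & scc_spec_rad i = r]} ->
  exists x, [/\ {in S, forall a, 0 < x a 0},
                forall a, a \notin S -> x a 0 = 0 &
                {in S, forall a, (A *m x) a 0 = r * x a 0}].
Proof.
move=> S_sink; have [w w_perron] := fin_all_exists scc_perron_vector.
have sumE a : (\sum_(i in S) w i) a 0 = \sum_(i in S) w i a 0 by rewrite summxE.
exists (\sum_(i in S) w i); split=> a aS.
- rewrite sumE (bigD1 a) //= ltr_pwDl ?sumr_ge0 //.
    by have [_ + _ _] := w_perron a; apply; apply: scc_of_refl.
  by move=> i _; have [+ _ _ _] := w_perron i.
- rewrite sumE big1 // => i /S_sink[/subsetP sub_iS _ _].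
  by have [_ _ + _] := w_perron i; apply; apply: contra aS => /sub_iS.
rewrite mulmx_sumr summxE sumE mulr_sumr; apply: eq_bigr => i iS.
have [_ _ w_out w_eig] := w_perron i; have [_ _ i_r] := S_sink i iS.
have [ai|ai] := boolP (a \in scc_of A i); first by rewrite w_eig // i_r.
rewrite w_out // mulr0 mxE big1 // => b _.
have [_ /is_sinkP a_sink _] := S_sink a aS.
have [->|A_ab] := eqVneq (A a b) 0; first by rewrite mul0r.
rewrite w_out ?mulr0 //; apply: contra ai => /scc_of_eq <-.
rewrite (scc_of_eq (a_sink a b (scc_of_refl A a) _)) ?scc_of_refl //.
by rewrite lt_def A_ab A_ge0.
Qed.

Lemma subinvariant_glue T r x y :
    (forall i, i \notin T -> 0 < x i 0) -> {in T, forall i, x i 0 = 0} ->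
    (forall i, i \notin T -> (A *m x) i 0 <= r * x i 0) ->
    {in T, forall i, 0 < y i 0} -> (forall i, i \notin T -> y i 0 = 0) ->
    {in T, forall i, (A *m y) i 0 < r * y i 0} ->
    (forall i j, i \notin T -> j \in T -> A i j = 0) ->
  exists2 z, pos_vec z & subinvariant A r z.
Proof.
move=> x_gt0 x_out x_sub y_gt0 y_out y_sub noedge.
have x_ge0 : nonneg_vec x.
  by move=> i; have [/x_out->|/x_gt0/ltW] := boolP (i \in T).
have d_gt0 : {in T, forall i, 0 < r * y i 0 - (A *m y) i 0}.
  by move=> i iT; rewrite subr_gt0 y_sub.
have [t t_gt0 t_ge] := exists_multiple_ge (nonneg_mulmx A_ge0 x_ge0) d_gt0.
have addE (u v : 'cV[C]_m) i : (u + t *: v) i 0 = u i 0 + t * v i 0.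
  by rewrite !mxE.
exists (x + t *: y) => i.
  rewrite addE; have [iT|iT] := boolP (i \in T).
    by rewrite x_out // add0r mulr_gt0 ?y_gt0.
  by rewrite y_out // mulr0 addr0 x_gt0.
rewrite mulmxDr -scalemxAr !addE; have [iT|iT] := boolP (i \in T).
  by rewrite x_out // add0r mulrCA -lerBrDr -mulrBr t_ge.
suff -> : (A *m y) i 0 = 0 by rewrite y_out // !mulr0 !addr0 x_sub.
rewrite mxE big1 // => j _.
by have [jT|/y_out->] := boolP (j \in T); rewrite ?mulr0 // noedge ?mul0r.
Qed.

Lemma exists_subinvariant :
    (forall i, scc_spec_rad i = spec_rad A -> is_sink A (scc_of A i)) ->
  exists2 x, pos_vec x & subinvariant A (spec_rad A) x.
Proof.
move=> max_sink; pose T := [set i | scc_spec_rad i != spec_rad A].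
have scc_T i j : j \in scc_of A i -> (j \in T) = (i \in T).
  by move=> ji; rewrite !inE /scc_spec_rad (scc_of_eq ji).
have T_sink : {in ~: T, forall i, [/\ scc_of A i \subset ~: T,
    is_sink A (scc_of A i) & scc_spec_rad i = spec_rad A]}.
  move=> i iT; have i_max : scc_spec_rad i = spec_rad A.
    by apply/eqP; rewrite !inE negbK in iT.
  split=> //; last exact: max_sink.
  by apply/subsetP => j /scc_T jT; rewrite inE jT -in_setC.
have [x [x_gt0 x_out Ax]] := sink_classes_eigenvector T_sink.
have [T0|T0] := eqVneq T set0.
  by exists x => i; rewrite ?Ax ?x_gt0 // T0 !inE.
have T_lt : spec_rad (psubmx A T) < spec_rad A.
  apply: spec_rad_psubmx_lt => // i; rewrite inE lt_neqAle => ->.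
  exact: scc_spec_rad_le.
have T_gt0 : (0 < #|T|)%N by rewrite card_gt0.
have [z z_gt0 z_sub] :=
  exists_strictly_subinvariant T_gt0 (psubmx_ge0 A_ge0) T_lt.
apply: (@subinvariant_glue T _ x (pad_vec z)) => [i iT|i iT|i iT|||| i j iT].
- by rewrite x_gt0 ?in_setC.
- by rewrite x_out // in_setC iT.
- by rewrite Ax ?in_setC.
- exact: pad_vec_gt0.
- exact: pad_vec_out.
- by apply: forall_in_enum_val => k; rewrite mulmx_pad_vec pad_vec_enum_val.
apply: contraTeq => A_ij; rewrite -in_setC in iT.
have [/subsetP sub_iT /is_sinkP i_sink _] := T_sink i iT.
rewrite -in_setC sub_iT // (i_sink i j) ?scc_of_refl //.
by rewrite lt_def A_ij A_ge0.
Qed.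

(* The support is closed under predecessors, hence contains a source class. *)
Lemma subinvariant_source r x :
    nonneg_vec x -> x != 0 -> subinvariant A r x ->
  exists2 i, is_source A (scc_of A i) & scc_spec_rad i <= r.
Proof.
move=> x_ge0 /cV0Pn[j xj] x_sub; pose Y := [set i | x i 0 != 0].
have Y0 : Y != set0 by apply/set0Pn; exists j; rewrite inE.
have gt0E i : (0 < x i 0) = (i \in Y) by rewrite inE lt_def x_ge0 andbT.
have Y_pred a b : reach A a b -> b \in Y -> a \in Y.
  by rewrite -!gt0E; apply: subinvariant_reach_gt0.
have rev_trans : transitive [rel a b | reach A b a].
  by move=> b a c ba cb; apply: reach_trans cb ba.
have rev_refl : reflexive [rel a b | reach A b a] := @reach_refl _ _ A.
have [i iY i_min] := preorder_maximal rev_refl rev_trans Y0.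
exists i.
  apply/is_sourceP => a b; rewrite !inE => /andP[_ bi] /reach_edge ab.
  have ai := reach_trans ab bi; rewrite ai andbT.
  exact: i_min (Y_pred a i ai iY) ai.
have x_subV := rowsub_subinvariant (U := scc_of A i) A_ge0 x_ge0 x_sub.
apply: spec_rad_le_subinvariant x_subV; first exact: card_scc_of_gt0.
  exact: psubmx_ge0.
move=> k; rewrite mxE gt0E; apply: Y_pred iY.
by have := enum_valP k; rewrite inE => /andP[].
Qed.

Lemma source_eigenvector i : is_source A (scc_of A i) ->
  exists w, [/\ nonneg_vec w, w != 0 & A *m w = scc_spec_rad i *: w].
Proof.
move=> /is_sourceP i_source.
have [w [w_ge0 w_gt0 w_out Aw]] := scc_perron_vector i.
exists w; split=> //.
  by apply/cV0Pn; exists i; rewrite gt_eqF // w_gt0 // scc_of_refl.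
apply/colP => a; rewrite [RHS]mxE.
have [/Aw//|ai] := boolP (a \in scc_of A i).
rewrite w_out // mulr0 mxE big1 // => b _.
have [bi|/w_out->] := boolP (b \in scc_of A i); last by rewrite mulr0.
suff -> : A a b = 0 by rewrite mul0r.
apply/eqP; apply: contraNT ai => A_ab.
by apply: i_source bi _; rewrite lt_def A_ab A_ge0.
Qed.

Hypothesis m_gt0 : (0 < m)%N.

Lemma exists_min_source : exists2 i, is_source A (scc_of A i) &
  forall j, is_source A (scc_of A j) -> scc_spec_rad i <= scc_spec_rad j.
Proof.
pose source : pred 'I_m := fun i =>
  excluded_middle_informative (is_source A (scc_of A i)).
have sourceP i : reflect (is_source A (scc_of A i)) (source i) := sumboolP _.
have [y [y_ge0 y0 Ay]] := perron_vector m_gt0 A_ge0.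
have [i0 /sourceP i0_source _] :=
  subinvariant_source y_ge0 y0 (eigenvector_subinvariant Ay).
have sccR i : scc_spec_rad i \is Num.real := ger0_real (scc_spec_rad_ge0 i).
case: (@real_arg_minP _ _ i0 source _ i0_source (fun i _ => sccR i)).
by move=> i /sourceP i_source i_min; exists i => // j /sourceP/i_min.
Qed.

End ComponentSpectralRadius.

(** * Extended ratios *)

Section ExtendedReals.
Variable C : numClosedFieldType.
Implicit Types (a b c : option C) (s u v : C).

Lemma lee_refl a : lee a a.
Proof. by case: a => /=. Qed.

Lemma lee_trans a b c : lee a b -> lee b c -> lee a c.
Proof. by case: a b c => [a|] [b|] [c|] //=; apply: le_trans. Qed.

Lemma lee_anti a b : lee a b -> lee b a -> a = b.
Proof. by case: a b => [a|] [b|] //= ab ba; congr Some; apply/le_anti/andP. Qed.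

Lemma maxe_lee a b c : lee (Some 0) a -> lee (Some 0) b ->
  lee (maxe a b) c = lee a c && lee b c.
Proof.
case: a b c => [a|] [b|] [c|] //=; rewrite ?andbF // => a_ge0 b_ge0.
have [ab|/ltW ba] := real_leP (ger0_real a_ge0) (ger0_real b_ge0).
  by apply/idP/andP => [bc|[]//]; rewrite bc (le_trans ab).
by apply/idP/andP => [ac|[]//]; rewrite ac (le_trans ba).
Qed.

Lemma bigmaxe_ge0 (I : Type) (e : seq I) (F : I -> option C) :
    (forall i, lee (Some 0) (F i)) ->
  lee (Some 0) (\big[@maxe C/Some 0]_(i <- e) F i).
Proof.
move=> F_ge0; elim/big_rec: _ => [|i a _]; first exact: lee_refl.
by case: (F i) a (F_ge0 i) => [b|] [a|] //= b_ge0 a_ge0; case: ifP.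
Qed.

Lemma bigmaxe_lee (I : Type) (e : seq I) (F : I -> option C) c :
    (forall i, lee (Some 0) (F i)) ->
  lee (\big[@maxe C/Some 0]_(i <- e) F i) c
    = lee (Some 0) c && all (fun i => lee (F i) c) e.
Proof.
move=> F_ge0; elim: e => [|i e IH]; first by rewrite big_nil andbT.
by rewrite big_cons maxe_lee ?bigmaxe_ge0 // IH /= andbCA.
Qed.

Lemma ratio_ge0 u v : 0 <= u -> 0 <= v -> lee (Some 0) (Defs.ratio u v).
Proof.
rewrite /Defs.ratio => u_ge0 v_ge0.
by case: eqP => _; [case: eqP => //= _; apply: lexx | apply: divr_ge0].
Qed.

Lemma ratio_lee u v s : 0 <= u -> 0 <= v -> 0 <= s ->
  lee (Defs.ratio u v) (Some s) = (u <= s * v).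
Proof.
rewrite /Defs.ratio => u_ge0 v_ge0 s_ge0; have [->|v0] := eqVneq v 0.
  by rewrite mulr0 eq_le u_ge0 andbT; case: ifP.
by rewrite /= ler_pdivrMr // lt_def v0.
Qed.

Lemma rfun_leP m n (A B : 'M[C]_(m, n)) (x : 'cV[C]_n) s :
    nonneg_vec (A *m x) -> nonneg_vec (B *m x) ->
  lee (rfun A B x) (Some s) <->
    0 <= s /\ forall i, (A *m x) i 0 <= s * (B *m x) i 0.
Proof.
move=> Ax_ge0 Bx_ge0.
have ratios_ge0 i : lee (Some 0) (Defs.ratio ((A *m x) i 0) ((B *m x) i 0)).
  exact: ratio_ge0.
rewrite /rfun bigmaxe_lee //; split=> [/andP[s_ge0 /allP le_s]|[s_ge0 le_s]].
  by split=> // i; rewrite -ratio_lee //; apply/le_s/mem_index_enum.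
by apply/andP; split=> //; apply/allP => i _; rewrite ratio_lee.
Qed.

End ExtendedReals.

Section CollatzWielandt.
Variables (C : numClosedFieldType) (m : nat) (A : 'M[C]_m).
Hypotheses (m_gt0 : (0 < m)%N) (A_ge0 : nonneg_mx A).
Implicit Types (x : 'cV[C]_m) (s : C).

Lemma rfun_subinvariantP x s : nonneg_vec x ->
  lee (rfun A 1%:M x) (Some s) <-> 0 <= s /\ subinvariant A s x.
Proof.
move=> x_ge0; have := @rfun_leP _ _ _ A 1%:M x s (nonneg_mulmx A_ge0 x_ge0).
by rewrite mul1mx; apply.
Qed.

Lemma rho_set_ge_spec_rad a : rho_set A 1%:M a -> lee (Some (spec_rad A)) a.
Proof.
case: a => [s|] // [x [x_gt0 xs]].
have [|_] := (rfun_subinvariantP s (pos_vecW x_gt0)).1.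
  by rewrite xs lee_refl.
exact: spec_rad_le_subinvariant.
Qed.

Lemma rho_eq_spec_rad : is_infe (rho_set A 1%:M) (Some (spec_rad A)).
Proof.
have r_ge0 := spec_rad_ge0 A m_gt0; split=> [|w w_lb].
  exact: rho_set_ge_spec_rad.
have w_le e : 0 < e -> lee w (Some (spec_rad A + e)).
  move=> e_gt0; have lt_r_re : spec_rad A < spec_rad A + e by rewrite ltrDl.
  have [x x_gt0 x_sub] := exists_strictly_subinvariant m_gt0 A_ge0 lt_r_re.
  apply: (lee_trans (w_lb (rfun A 1%:M x) _)); first by exists x.
  apply/rfun_subinvariantP; first exact: pos_vecW.
  by split; [rewrite addr_ge0 // ltW | apply: strictly_subinvariantW].
case: w {w_lb} w_le => [w|] w_le; first exact/ler_addgt0Pr.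
by have := w_le 1 ltr01.
Qed.

Lemma rfun_eq_spec_rad x : pos_vec x ->
  rfun A 1%:M x = Some (spec_rad A) <-> subinvariant A (spec_rad A) x.
Proof.
move=> x_gt0; have rfunP := rfun_subinvariantP (spec_rad A) (pos_vecW x_gt0).
split=> [xE|x_sub]; first by apply: (rfunP.1 _).2; rewrite xE lee_refl.
apply: lee_anti; last by apply: rho_set_ge_spec_rad; exists x.
by apply/rfunP; rewrite spec_rad_ge0.
Qed.

Lemma rhohat_eq_min_source i : is_source A (scc_of A i) ->
    (forall j, is_source A (scc_of A j) ->
       scc_spec_rad A i <= scc_spec_rad A j) ->
  is_infe (rhohat_set A 1%:M) (Some (scc_spec_rad A i)).
Proof.
move=> i_source i_min; split=> [[s|] // [x [x_ge0 [x0 xs]]]|v v_lb].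
  have [] := (rfun_subinvariantP s x_ge0).1; first by rewrite xs lee_refl.
  move=> _ /(subinvariant_source A_ge0 x_ge0 x0)[j j_source].
  exact: le_trans (i_min j j_source).
have [w [w_ge0 w0 Aw]] := source_eigenvector A_ge0 i_source.
apply: (lee_trans (v_lb (rfun A 1%:M w) _)); first by exists w.
apply/rfun_subinvariantP => //.
by split; [apply: scc_spec_rad_ge0 | apply: eigenvector_subinvariant].
Qed.

Lemma subinvariant_iff_sinks :
  (exists2 x, pos_vec x & subinvariant A (spec_rad A) x) <->
  (forall V, is_scc A V -> spec_rad (psubmx A V) = spec_rad A -> is_sink A V).
Proof.
split=> [[x x_gt0 x_sub] V /is_sccP[i ->] i_max|max_sink].
  apply/is_sinkP; apply: subinvariant_no_exit x_gt0 _; rewrite ?i_max //.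
  exact: scc_of_connected.
by apply: exists_subinvariant => // i; apply: max_sink; apply/is_sccP; exists i.
Qed.

End CollatzWielandt.

Theorem theorem3p2 (C : numClosedFieldType) (m : nat) (Hm : (0 < m)%N)
    (A : 'M[C]_m) (HA : nonneg_mx A) :
  (* (1) *)
  (is_infe (rho_set A 1%:M) (Some (spec_rad A)) /\
   exists y : 'cV[C]_m, nonneg_vec y /\ y != 0 /\ A *m y = spec_rad A *: y) /\
  (* (2) *)
  ((exists x : 'cV[C]_m, pos_vec x /\ rfun A 1%:M x = Some (spec_rad A)) <->
   (forall V, is_scc A V -> spec_rad (psubmx A V) = spec_rad A -> is_sink A V)) /\
  (* (3) *)
  (irreducible_mx A ->
   forall x1 x2 : 'cV[C]_m,
     pos_vec x1 -> \sum_i x1 i 0 = 1 -> rfun A 1%:M x1 = Some (spec_rad A) ->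
     pos_vec x2 -> \sum_i x2 i 0 = 1 -> rfun A 1%:M x2 = Some (spec_rad A) ->
     x1 = x2) /\
  (* (4) *)
  (exists v : C,
     ((exists V, is_scc A V /\ is_source A V /\ spec_rad (psubmx A V) = v) /\
      (forall V, is_scc A V -> is_source A V -> v <= spec_rad (psubmx A V))) /\
     is_infe (rhohat_set A 1%:M) (Some v) /\
     exists w : 'cV[C]_m, nonneg_vec w /\ w != 0 /\ A *m w = v *: w).
Proof.
split; [|split; [|split]].
- split; first exact: rho_eq_spec_rad.
  by have [y [? ? ?]] := perron_vector Hm HA; exists y.
- rewrite -(subinvariant_iff_sinks HA).
  split=> [[x [x_gt0 xE]]|[x x_gt0 x_sub]]; exists x => //.
    exact/rfun_eq_spec_rad.
  by split=> //; apply/rfun_eq_spec_rad.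
- move=> A_irr x1 x2 x1_gt0 sum1 /(rfun_eq_spec_rad Hm HA x1_gt0) x1_sub.
  move=> x2_gt0 sum2 /(rfun_eq_spec_rad Hm HA x2_gt0) x2_sub.
  by apply: irreducible_subinvariant_unique sum1 x1_sub _ sum2 x2_sub => //;
    apply/nonneg_vec_real/pos_vecW.
have [i i_source i_min] := exists_min_source HA Hm.
exists (scc_spec_rad A i); split; [split|split].
- by exists (scc_of A i); split; [apply/is_sccP; exists i|].
- by move=> V /is_sccP[j ->]; apply: i_min.
- exact: rhohat_eq_min_source.
by have [w [? ? ?]] := source_eigenvector HA i_source; exists w.
Qed.
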